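(* Let $n\ge3$. The set $\mathcal{D}_n$ of self-dual elements of $\mathcal{E}_n$ is in a natural bijection with $\mathcal{E}_{(n+2)/2}$ if $n$ is even and with $\mathcal{A}_{(n+3)/2}$ if $n$ is odd. In particular, there are $F_{n-2}$ self-dual combinatorial types of plane branches of blow-up complexity $n$.
   Context: Fibonacci numbers: $F_0=0$, $F_1=1$, $F_{n+1}=F_n+F_{n-1}$ for $n\ge1$. A plane branch is a reduced irreducible germ $(C,O)$ of complex analytic curve on a germ $(\mathcal{S},O)$ of smooth complex analytic surface. A model over $(\mathcal{S},O)$ is a composition of finitely many blow-ups of points above $O$. An infinitely near point of $O$ is a point lying over $O$ on some model, two such points being identified when the bimeromorphic map between the models is an isomorphism near them. $E(P)$ denotes the exceptional curve created by blowing up $P$, and also its strict transforms. $Q$ is proximate to $P$ if $Q\in E(P)$. A point $\neq O$ is free if it is proximate to exactly one point, and satellite if it is proximate to two. The minimal embedded resolution of $(C,O)$ is obtained by repeatedly blowing up the unique point where the total transform of $C$ is not a normal crossing. Let $P_0=O,P_1,\dots,P_{n-1}$ be the points blown up, in order; $n$ is the blow-up complexity of $C$ ($n=0$ if $C$ is smooth, $n\ge3$ otherwise). Enriques diagram of $C$ (for $n\ge3$): the path graph with vertices $v_0,\dots,v_{n-1}$ (with $v_i$ corresponding to $P_i$) and edges $e_i=[v_{i-1}v_i]$, $1\le i\le n-1$, where each edge is decorated as curved or straight and each vertex as breaking or neutral, as follows. A straight path is a path of straight edges all of whose interior vertices are neutral; it is maximal if adding an adjacent edge never gives a straight path. (1)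 $e_i$ is curved iff $P_i$ is free. (2) If $P_{i+1},\dots,P_k$ are all the points of the sequence proximate to $P_i$ and $k\ge i+2$, then $[v_{i+1}v_k]$ is a maximal straight path, and if moreover $e_{i+1}$ is straight then $v_{i+1}$ is a breaking vertex. All other vertices are neutral. $\mathcal{E}_n$ is the set of isomorphism classes of Enriques diagrams of plane branches of blow-up complexity $n$; the combinatorial type of a plane branch is encoded by its Enriques diagram, and elements of $\mathcal{E}_n$ are identified with the combinatorial types of plane branches of blow-up complexity $n$. Always $e_1$ is curved, $e_{n-1}$ is straight and $v_0,v_1,v_{n-1}$ are neutral; a decoration with these properties is an Enriques diagram of complexity $n$ iff both edges adjacent to every breaking vertex are straight. $\mathcal{A}_n\subseteq\mathcal{E}_n$ is the set of Enriques diagrams of complexity $n$ whose vertex $v_{n-2}$ is neutral. The dual Enriques diagram $\Delta_n(\epsilon)\in\mathcal{E}_n$ of $\epsilon\in\mathcal{E}_n$ is defined by the following rules, for $2\le k\le n-2$: $v_k$ is a breaking vertex in $\Delta_n(\epsilon)$ iff $e_{n-k}$ is a curved edge in $\epsilon$; $e_k$ is a straight edge in $\Delta_n(\epsilon)$ iff $v_{n-k}$ is a neutral vertex in $\epsilon$. A diagram $\epsilon$ (or the corresponding combinatorial type) is self-dual if $\Delta_n(\epsilon)=\epsilon$. *)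

(* Defs.v *)
From HB Require Import structures.
From mathcomp Require Import all_boot all_order all_algebra complex.
From mathcomp Require Import all_classical all_reals all_analysis.

Set Implicit Arguments.
Unset Strict Implicit.
Unset Printing Implicit Defensive.

Import Order.TTheory GRing.Theory Num.Theory.
Import numFieldNormedType.Exports.

Local Open Scope classical_set_scope.
Local Open Scope ring_scope.
Local Open Scope card_scope.

Fixpoint fib (n : nat) : nat :=
  match n with
  | 0 => 0
  | 1 => 1
  | (m.+1 as p).+1 => fib p + fib m
  end%N.

(* R[i], declared as a numClosedFieldType so that it inherits its topology. *)
Definition CC (R : realType) : numClosedFieldType := R[i].

Definition holomorphic_germ (R : realType) (f : CC R -> CC R) : Prop :=
  \forall z \near (0 : CC R), derivable f z 1.

(* A point P on a model, with local coordinates (x, y) centred at P in which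
   every exceptional curve through P is a coordinate axis.  The strict
   transform of the branch is parametrised by t |-> (xpar t, ypar t); xexc is
   Some i when the axis x = 0 is the exceptional curve E(P_i), and None when
   this axis is not exceptional; likewise yexc for the axis y = 0. *)
Record local_transform (R : realType) := LocalTransform {
  xpar : CC R -> CC R;
  ypar : CC R -> CC R;
  xexc : option nat;
  yexc : option nat }.

Definition germ_at_origin (R : realType) (s : local_transform R) : Prop :=
  [/\ holomorphic_germ (xpar s), holomorphic_germ (ypar s),
      xpar s 0 = 0 & ypar s 0 = 0].

(* A plane branch is given, in local coordinates of the smooth surface at O, by
   its normalisation: a holomorphic map germ (C, 0) -> (C^2, 0) which is
   injective near 0.  There is no exceptional curve at O. *)
Definition plane_branch (R : realType) (s : local_transform R) : Prop :=
  [/\ germ_at_origin s,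
      exists2 U : set (CC R), nbhs (0 : CC R) U &
        set_inj U (fun t => (xpar s t, ypar s t)),
      xexc s = None & yexc s = None].

(* Blow-up of P_i (seen by s), then passage to the point (seen by s') where the
   strict transform of the branch meets E(P_i).  The points of E(P_i) are the
   directions at P_i: the direction y = c x is the origin of the coordinates
   (u, v) with x = u, y = u (c + v), in which E(P_i) is u = 0; the direction
   x = 0 is the origin of (u, v) with x = u v, y = v, in which E(P_i) is v = 0.
   The strict transform of an axis passes through the new point only when the
   direction is that of this axis. *)
Definition blow_up (R : realType) (i : nat) (s s' : local_transform R) : Prop :=
  germ_at_origin s' /\
  ((exists c : CC R,
      [/\ \forall t \near (0 : CC R), xpar s t = xpar s' t,
          \forall t \near (0 : CC R), ypar s t = xpar s' t * (c + ypar s' t),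
          xexc s' = Some i
        & yexc s' = if c == 0 then yexc s else None])
   \/
   [/\ \forall t \near (0 : CC R), xpar s t = xpar s' t * ypar s' t,
       \forall t \near (0 : CC R), ypar s t = ypar s' t,
       xexc s' = xexc s
     & yexc s' = Some i]).

(* The parametrisation being injective, its image is smooth iff its velocity at
   0 does not vanish. *)
Definition smooth_at (R : realType) (s : local_transform R) : Prop :=
  derive1 (xpar s) 0 != 0 \/ derive1 (ypar s) 0 != 0.

(* The total transform is a normal crossing at P: the strict transform is
   smooth, and it is transversal to the only exceptional curve through P, if
   there is any. *)
Definition normal_crossing (R : realType) (s : local_transform R) : Prop :=
  [/\ smooth_at s,
      xexc s = None \/ yexc s = None,
      xexc s <> None -> derive1 (xpar s) 0 != 0
    & yexc s <> None -> derive1 (ypar s) 0 != 0].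

(* S 0, ..., S (n - 1) are the points P_0, ..., P_(n-1) blown up by the minimal
   embedded resolution of the branch S 0; S n is the point of the final model
   on the strict transform.  Away from the strict transform the total transform
   consists of exceptional curves, so it is a normal crossing there. *)
Definition minimal_resolution (R : realType) (n : nat)
    (S : nat -> local_transform R) : Prop :=
  [/\ plane_branch (S 0%N),
      forall i, (i < n)%N -> ~ normal_crossing (S i) /\ blow_up i (S i) (S i.+1)
    & normal_crossing (S n)].

(* P_j is proximate to P_i. *)
Definition proximate (R : realType) (S : nat -> local_transform R)
    (j i : nat) : Prop :=
  xexc (S j) = Some i \/ yexc (S j) = Some i.

Definition free_point (R : realType) (S : nat -> local_transform R)
    (j : nat) : Prop :=
  exists! i : nat, proximate S j i.

(* P_(i+1), ..., P_k are all the points among P_0, ..., P_(n-1) which are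
   proximate to P_i. *)
Definition proximate_run (R : realType) (S : nat -> local_transform R)
    (n i k : nat) : Prop :=
  (k < n)%N /\ forall j, (j < n)%N -> (proximate S j i <-> (i < j <= k)%N).

(* Decorations of the path graph v_0, ..., v_(n-1): the first component says
   which vertices are breaking (the others are neutral), the second which edges
   are straight (the others are curved), e_k being stored at index k - 1.  The
   vertices of the path are ordered from the root v_0, so an isomorphism class
   is a decoration. *)
Definition diagram (n : nat) : Type :=
  ({ffun 'I_n -> bool} * {ffun 'I_n.-1 -> bool})%type.

Definition breaking (n : nat) (d : diagram n) (k : nat) : bool :=
  oapp d.1 false (insub k).

Definition straight (n : nat) (d : diagram n) (k : nat) : bool :=
  (0 < k)%N && oapp d.2 false (insub k.-1).

(* The path [v_a v_b] is straight. *)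
Definition straight_path (n : nat) (d : diagram n) (a b : nat) : Prop :=
  [/\ (a <= b < n)%N,
      forall k, (a < k <= b)%N -> straight d k
    & forall k, (a < k < b)%N -> ~~ breaking d k].

Definition maximal_straight_path (n : nat) (d : diagram n) (a b : nat) : Prop :=
  [/\ straight_path d a b,
      (0 < a)%N -> ~ straight_path d a.-1 b
    & (b.+1 < n)%N -> ~ straight_path d a b.+1].

Definition is_enriques_diagram (R : realType) (n : nat)
    (S : nat -> local_transform R) (d : diagram n) : Prop :=
  [/\ forall i, (0 < i < n)%N -> (~~ straight d i <-> free_point S i),
      forall i k, (i.+2 <= k)%N -> proximate_run S n i k ->
        maximal_straight_path d i.+1 k
    & forall j, (j < n)%N ->
        (breaking d j <->
         exists i k, [/\ j = i.+1, (i.+2 <= k)%N, proximate_run S n i k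
                       & straight d i.+1])].

Definition enriques (R : realType) (n : nat) : set (diagram n) :=
  [set d | exists2 S : nat -> local_transform R,
     minimal_resolution n S & is_enriques_diagram S d].

Arguments enriques R n : clear implicits.

(* The set A_n. *)
Definition enriques_neutral (R : realType) (n : nat) : set (diagram n) :=
  [set d | enriques R n d /\ ~~ breaking d (n - 2)].

Arguments enriques_neutral R n : clear implicits.

(* Outside the range 2 <= k <= n - 2 the decorations are those common to all
   Enriques diagrams: v_0, v_1, v_(n-1) are neutral, e_1 is curved, e_(n-1) is
   straight. *)
Definition dual (n : nat) (d : diagram n) : diagram n :=
  ([ffun k : 'I_n => (2 <= k <= n - 2)%N && ~~ straight d (n - k)],
   [ffun j : 'I_n.-1 =>
      let k := j.+1 in
      if (2 <= k <= n - 2)%N then ~~ breaking d (n - k) else k == n.-1]).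

Definition self_dual (R : realType) (n : nat) : set (diagram n) :=
  [set d | enriques R n d /\ dual d = d].

Arguments self_dual R n : clear implicits.

(* The subdiagram on v_0, ..., v_(m-1), in which v_(m-1), being now an end of
   the path, is declared neutral. *)
Definition initial_part (n m : nat) (d : diagram n) : diagram m :=
  ([ffun k : 'I_m => (k.+1 < m)%N && breaking d k],
   [ffun j : 'I_m.-1 => straight d j.+1]).

(* Main.v *)
Require Import Defs.
From mathcomp Require Import all_boot all_order all_algebra complex.
From mathcomp Require Import all_classical all_reals all_analysis.
From mathcomp Require Import zify.

(* A decoration with e_1 curved, e_(n-1) straight and both edges at every
   breaking vertex straight is an Enriques diagram.  Conversely, e_(n-1) is
   straight because a blow-up can only create a normal crossing at a satellite
   point.  To realize a decoration, read off it the successive choices of the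
   next point on the new exceptional curve, and compose the corresponding
   charts from the last point down to O, starting with the germ (t, t).

   Write such a decoration as the word v_0, e_1, v_1, e_2, ..., v_(n-1), where a
   breaking vertex or a curved edge is a true letter: the condition says that no
   two consecutive letters are true.  Duality reverses the word between e_2 and
   v_(n-2), so a self-dual diagram is a palindrome there; its two middle letters
   coincide, hence are false, and the n - 4 letters before them are an arbitrary
   word without two consecutive true letters. *)

Set Implicit Arguments.
Unset Strict Implicit.
Unset Printing Implicit Defensive.

Import Order.TTheory GRing.Theory Num.Theory.
Import numFieldNormedType.Exports.

Local Open Scope classical_set_scope.
Local Open Scope ring_scope.
Local Open Scope card_scope.

(** * Normal crossings and blow-ups *)

Lemma holomorphic_germ0 (R : realType) (f : CC R -> CC R) :
  holomorphic_germ f -> derivable f 0 1.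
Proof. exact: nbhs_singleton. Qed.

Lemma near_eq_derive1 (K : numFieldType) (f g : K -> K) (a : K) :
  (\forall t \near a, f t = g t) -> derive1 f a = derive1 g a.
Proof. by move=> fg; rewrite !derive1E; apply: near_eq_derive. Qed.

Lemma derive1_mul_root (K : numFieldType) (f u v : K -> K) (a c : K) :
  (\forall t \near a, f t = u t * (c + v t)) ->
  derivable u a 1 -> derivable v a 1 -> u a = 0 -> v a = 0 ->
  derive1 f a = derive1 u a * c.
Proof.
move=> fE du dv u0 v0.
have -> : derive1 f a = derive1 (u * (cst c + v)) a by exact: near_eq_derive1.
have dw : derivable (cst c + v) a 1.
  by apply: derivableD dv; exact: derivable_cst.
rewrite !derive1E deriveM // u0 scale0r add0r [_ *: _]mulrC.
by congr (_ * _); rewrite -[RHS]addr0 -v0.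
Qed.

Lemma blow_up_derive1 (R : realType) (i : nat) (s s' : local_transform R) :
  blow_up i s s' ->
  (exists c : CC R,
    [/\ derive1 (xpar s) 0 = derive1 (xpar s') 0,
        derive1 (ypar s) 0 = derive1 (xpar s') 0 * c,
        xexc s' = Some i & yexc s' = if c == 0 then yexc s else None])
  \/ [/\ derive1 (xpar s) 0 = 0,
         derive1 (ypar s) 0 = derive1 (ypar s') 0,
         xexc s' = xexc s & yexc s' = Some i].
Proof.
move=> [[/holomorphic_germ0 dx /holomorphic_germ0 dy x0 y0] h].
case: h => [[c [ex ey hx hy]]|[ex ey hx hy]].
  left; exists c; split.
  - exact: near_eq_derive1 ex.
  - exact: derive1_mul_root ey dx dy x0 y0.
  - exact: hx.
  - exact: hy.
right; split.
- rewrite -[RHS](mulr0 (derive1 (xpar s') 0)).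
  apply: derive1_mul_root dx dy x0 y0.
  by apply: filterS ex => t ->; rewrite add0r.
- exact: near_eq_derive1 ey.
- exact: hx.
- exact: hy.
Qed.

(** [normal_crossing] depends only on the velocity [(a, b)] and the labels of the axes, so the chart
    lemmas become statements about a field. *)
Definition crossing (K : fieldType) (a b : K) (X Y : option nat) : Prop :=
  [/\ a != 0 \/ b != 0, X = None \/ Y = None,
      X <> None -> a != 0 & Y <> None -> b != 0].

Lemma crossing_chart1 (K : fieldType) (a b c : K) (i : nat)
    (X Y : option nat) :
  crossing a (a * c) X Y ->
  crossing a b (Some i) (if c == 0 then Y else None).
Proof.
case=> sm _ _ ty.
have a0 : a != 0.
  by case: sm => //; apply: contra_neq => ->; rewrite mul0r.
suff -> : (if c == 0 then Y else None) = None by split; auto.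
case: eqP => // c0; case: Y ty => // j ty.
have /ty : Some j <> None by [].
by rewrite c0 mulr0 eqxx.
Qed.

Lemma crossing_chart2 (K : fieldType) (a b : K) (i : nat) (X Y : option nat) :
  crossing 0 b X Y -> crossing a b X (Some i).
Proof.
case=> sm _ tx _; have b0 : b != 0 by case: sm => //; rewrite eqxx.
case: X tx => [j tx|_]; last by split; auto.
have /tx : Some j <> None by [].
by rewrite eqxx.
Qed.

(** A nonzero [a] makes the branch smooth and transversal to x = 0 already before the blow-up. An
    exceptional axis y = 0 has to be left behind, so [c != 0] and the branch was transversal to it
    too. Only the presence of both axes can have been the obstruction. *)
Lemma chart1_crossing_created (K : fieldType) (a b c : K) (i : nat)
    (X Y : option nat) :
  ~ crossing a (a * c) X Y ->
  crossing a b (Some i) (if c == 0 then Y else None) -> X <> None /\ Y <> None.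
Proof.
move=> nc [_ ee tx _]; have a0 : a != 0 by apply: tx.
case: Y => [j|] in nc ee *; last by case: nc; split; auto.
have c0 : c != 0 by case: eqP ee => // _ [].
case: X => [k|] // in nc *; case: nc; split; auto.
by rewrite mulf_neq0.
Qed.

Lemma chart2_crossing_created (K : fieldType) (a b : K) (i : nat)
    (X Y : option nat) :
  ~ crossing 0 b X Y -> crossing a b X (Some i) -> X <> None /\ Y <> None.
Proof.
move=> nc [_ [X0|//] _ ty]; have b0 : b != 0 by apply: ty.
by case: nc; rewrite X0; split; auto.
Qed.

Lemma normal_crossing_blow_up (R : realType) (i : nat)
    (s s' : local_transform R) :
  blow_up i s s' -> normal_crossing s -> normal_crossing s'.
Proof.
rewrite /normal_crossing /smooth_at.
move=> /blow_up_derive1[[c [-> -> -> ->]]|[-> -> -> ->]].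
  exact: crossing_chart1.
exact: crossing_chart2.
Qed.

Lemma normal_crossing_created (R : realType) (i : nat)
    (s s' : local_transform R) :
  blow_up i s s' -> ~ normal_crossing s -> normal_crossing s' ->
  xexc s <> None /\ yexc s <> None.
Proof.
rewrite /normal_crossing /smooth_at.
move=> /blow_up_derive1[[c [-> -> -> ->]]|[-> -> -> ->]].
  exact: chart1_crossing_created.
exact: chart2_crossing_created.
Qed.

(** * Proximity and Enriques diagrams of branches *)

Section ExceptionalCurves.
Variables (R : realType) (n : nat) (S : nat -> local_transform R).
Hypothesis resS : minimal_resolution n S.

Lemma exceptional_step (j : nat) : (j < n)%N ->
  (xexc (S j.+1) = Some j /\
    (yexc (S j.+1) = yexc (S j) \/ yexc (S j.+1) = None)) \/
  (xexc (S j.+1) = xexc (S j) /\ yexc (S j.+1) = Some j).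
Proof.
case: resS => _ step _ /step[_ [_ [[c [_ _ -> ->]]|[_ _ -> ->]]]];
  last by right.
by left; split=> //; case: eqP; [left|right].
Qed.

Lemma proximate0 (i : nat) : ~ proximate S 0 i.
Proof. by case: resS => -[_ _ x0 y0] _ _; rewrite /proximate x0 y0 => -[]. Qed.

Lemma proximate_succ (j : nat) : (j < n)%N -> proximate S j.+1 j.
Proof. by case/exceptional_step => -[ex ey]; [left|right]. Qed.

Lemma proximate_pred (i j : nat) : (j < n)%N ->
  proximate S j.+1 i -> i = j \/ proximate S j i.
Proof.
rewrite /proximate; case/exceptional_step => -[-> ].
  by move=> [->|->] [[->]|e]; auto.
by move=> -> [e|[->]]; auto.
Qed.

Lemma proximate_uniq (i i' j : nat) : (j < n)%N ->
  proximate S j.+1 i -> proximate S j.+1 i' -> [\/ i = j, i' = j | i = i'].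
Proof.
rewrite /proximate; case/exceptional_step => -[-> ].
  move=> [->|->] [[->]|e] [[->]|e']; try by constructor.
  by move: e; rewrite e' => -[->]; constructor 3.
move=> -> [e|[->]] [e'|[->]]; try by constructor.
by move: e; rewrite e' => -[->]; constructor 3.
Qed.

Lemma proximate_lt (i j : nat) : (j <= n)%N -> proximate S j i -> (i < j)%N.
Proof.
elim: j i => [|j IH] i jn; first by move/proximate0.
by case/(proximate_pred jn) => [->//|/(IH _ (ltnW jn))]; lia.
Qed.

(** Once the branch leaves [E(P_i)] it never meets it again, by [proximate_pred]; hence the points
    proximate to [P_i] are consecutive. *)
Lemma proximate_between (i j k : nat) :
  (k <= n)%N -> (i < j <= k)%N -> proximate S k i -> proximate S j i.
Proof.
elim: k => [|k IH] kn ijk; first by lia.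
have [->//|jk] := eqVneq j k.+1.
by case/(proximate_pred kn) => [|/IH]; [lia|apply; lia].
Qed.

Lemma free_pointE (j : nat) : (j < n)%N ->
  free_point S j.+1 <-> forall i, proximate S j.+1 i -> i = j.
Proof.
move=> jn; have pj := proximate_succ jn; split=> [[i [_ iu]] k pk|ju].
  by rewrite -(iu _ pk) (iu _ pj).
by exists j; split=> // k /ju.
Qed.

Lemma satellite_point (j : nat) : (j < n)%N -> ~ free_point S j.+1 ->
  exists2 i, proximate S j.+1 i & i <> j.
Proof.
move=> jn nf; apply: contrapT => h; apply: nf; apply/free_pointE => // i pi.
by apply: contrapT => ij; apply: h; exists i.
Qed.

(** One of the two labels is carried over from [S j], hence is smaller than [j], whereas freeness
    forces both to equal [j]. *)
Lemma two_exceptional_not_free (j : nat) : (j < n)%N ->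
  xexc (S j.+1) <> None -> yexc (S j.+1) <> None -> ~ free_point S j.+1.
Proof.
move=> jn; case X : (xexc _) => [a|] // _;
  case Y : (yexc _) => [b|] // _ /free_pointE.
move=> /(_ jn) fr.
have := fr a (or_introl X); have := fr b (or_intror Y) => bj aj.
move: X Y; rewrite aj bj; case: (exceptional_step jn) => -[ex ey].
  rewrite ex => _; case: ey => -> // Y.
  by have := proximate_lt (ltnW jn) (or_intror Y); rewrite ltnn.
rewrite ex => X _.
by have := proximate_lt (ltnW jn) (or_introl X); rewrite ltnn.
Qed.

Lemma last_point_satellite : (1 < n)%N -> ~ free_point S n.-1.
Proof.
move=> n1; case: (resS) => _ step ncn.
have [j nj] : exists j, n = j.+2 by exists n.-2; lia.
have [|nc bl] := step j.+1; first by lia.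
rewrite nj in ncn *.
have [x0 y0] := normal_crossing_created bl nc ncn.
by apply: two_exceptional_not_free; rewrite // nj.
Qed.

Lemma proximate_run_exists (i j : nat) : (i < j < n)%N -> proximate S j i ->
  exists2 k, (j <= k)%N & proximate_run S n i k.
Proof.
move=> /andP[ij jn] pj.
pose P k := (k < n)%N && `[< proximate S k i >].
have [||k /andP[kn /asboolP pk] kmax] := @ex_maxnP P n.
- by exists j; rewrite /P jn; apply/asboolP.
- by move=> k /andP[/ltnW].
exists k; first by apply: kmax; rewrite /P jn; apply/asboolP.
split=> // l ln; split=> [pl|ilk].
  apply/andP; split; first exact: proximate_lt (ltnW ln) pl.
  by apply: kmax; rewrite /P ln; apply/asboolP.
exact: proximate_between (ltnW kn) ilk pk.
Qed.

Variable d : diagram n.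
Hypothesis straightE :
  forall i, (0 < i < n)%N -> (~~ straight d i <-> free_point S i).
Hypothesis breakingE : forall j, (j < n)%N ->
  (breaking d j <->
   exists i k, [/\ j = i.+1, (i.+2 <= k)%N, proximate_run S n i k
                 & straight d i.+1]).

Lemma straight_satellite (i j : nat) : (j.+1 < n)%N -> proximate S j.+1 i ->
  i <> j -> straight d j.+1.
Proof.
move=> jn pi ij; apply/negPn/negP => /(straightE _).1 fr; apply: ij.
by have /(free_pointE (ltnW jn)) := fr jn; apply.
Qed.

(** The clause on maximal straight paths follows from the other two. To the left, a straight
    [e_(i+1)] makes [v_(i+1)] breaking. To the right, a straight [e_(k+1)] makes [P_(k+1)] proximate
    to [P_(k-1)], since proximity to [P_i] would lengthen the run; then [v_k] is breaking. *)
Lemma maximal_straight_run (i k : nat) : (i.+2 <= k)%N ->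
  proximate_run S n i k -> maximal_straight_path d i.+1 k.
Proof.
move=> ik run; have [kn runE] := run.
have pr j : (i < j <= k)%N -> proximate S j i by move=> ijk; apply/runE; lia.
have st j : (i.+1 < j <= k)%N -> straight d j.
  case: j => [|j] ijk; first by lia.
  by apply: (@straight_satellite i); [lia|apply: pr; lia|lia].
split.
- split=> // [|j ijk]; first by lia.
  (* A breaking interior vertex [v_(i'+1)] would make [P_(i'+2)] proximate to three points: [P_i],
     [P_i'] and [P_(i'+1)]. *)
  apply/negP => /breakingE -/(_ ltac:(lia))[i' [k' [ji' ik' [kn' runE'] _]]].
  subst j.
  have pi' : proximate S i'.+2 i' by apply/runE'; lia.
  have pi : proximate S i'.+2 i by apply: pr; lia.
  have i'n : (i'.+1 < n)%N by lia.
  by case: (proximate_uniq i'n pi pi'); lia.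
- move=> _ [_ st' /(_ i.+1)]; rewrite leqnn ik => /(_ isT)/negP; apply.
  apply/breakingE; first by lia.
  by exists i, k; split=> //; apply: st'; lia.
- move=> kn' [_ st' /(_ k)]; rewrite leqnn ik => /(_ isT)/negP; apply.
  have nf : ~ free_point S k.+1.
    by move=> /(straightE (i := k.+1) kn').2; rewrite st' //; lia.
  have [l pl lk] := satellite_point kn nf.
  have plk : proximate S k l by case: (proximate_pred kn pl).
  have [m km] : exists m, k = m.+1 by exists k.-1; lia.
  subst k.
  have pim : proximate S m.+1 i by apply: pr; lia.
  have mn : (m < n)%N by lia.
  case: (proximate_uniq mn pim plk) => [|lm|il]; first by lia.
    subst l; apply/breakingE => //.
    have [|k' mk' run'] := @proximate_run_exists m m.+2 _ pl; first by lia.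
    by exists m, k'; split=> //; apply: st; lia.
  by subst l; have /runE := pl; lia.
Qed.

End ExceptionalCurves.

Definition admissible (n : nat) (d : diagram n) : Prop :=
  [/\ ~~ straight d 1, straight d n.-1
    & forall k, breaking d k -> straight d k && straight d k.+1].

Lemma breaking_lt (n : nat) (d : diagram n) (k : nat) :
  breaking d k -> (k < n)%N.
Proof. by rewrite /breaking; case: insubP. Qed.

Lemma straight_lt (n : nat) (d : diagram n) (k : nat) :
  straight d k -> (0 < k < n)%N.
Proof.
rewrite /straight; case/andP => k0; case: insubP => //= _ + _ _; lia.
Qed.

Lemma enriques_admissible (R : realType) (n : nat) (d : diagram n) :
  (3 <= n)%N -> enriques R n d -> admissible d.
Proof.
move=> n3 [S res [stE _ brE]]; split.
- apply/stE; first by lia.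
  apply/(free_pointE res); first by lia.
  move=> i /(proximate_pred res); case=> //; first by lia.
  by move/(proximate0 res).
- apply/negPn/negP => /stE fr; apply: (last_point_satellite res); first by lia.
  by apply: fr; lia.
- move=> k br; have kn := breaking_lt br.
  have /brE[//|i [l [-> il [ln run] ->]]] := br.
  apply: (straight_satellite res stE); first by lia.
    by apply/run; lia.
  by lia.
Qed.

(** * Blowing down germs *)

(* The inverses of three blow-up charts: [None] is the direction y = x, along
   no axis; [Some false] and [Some true] are the directions of the axes y = 0
   and x = 0, whose strict transforms pass through the new point. *)
Definition blow_down (K : numFieldType) (m : option bool)
    (g : (K -> K) * (K -> K)) : (K -> K) * (K -> K) :=
  match m with
  | None => (g.1, fun t => g.1 t * (1 + g.2 t))
  | Some false => (g.1, fun t => g.1 t * (0 + g.2 t))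
  | Some true => (fun t => g.1 t * g.2 t, g.2)
  end.

(** Derivability everywhere avoids shrinking domains along the charts; isolation of the zeros is
    what keeps the germs injective. *)
Definition isolated_zero (K : numFieldType) (f : K -> K) : Prop :=
  [/\ forall t, derivable f t 1, f 0 = 0
    & \forall t \near (0 : K), f t = 0 -> t = 0].

Definition near_injective (K : numFieldType) (g : (K -> K) * (K -> K)) : Prop :=
  exists2 U : set K, nbhs (0 : K) U & set_inj U (fun t => (g.1 t, g.2 t)).

Lemma derivable_addc (K : numFieldType) (c : K) (v : K -> K) :
  (forall t, derivable v t 1) -> forall t, derivable (fun t => c + v t) t 1.
Proof.
move=> dv t.
exact: (@derivableD _ _ _ (cst c) v t 1 (derivable_cst c t 1) (dv t)).
Qed.

Lemma isolated_zeroM (K : numFieldType) (u w : K -> K) :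
  isolated_zero u -> (forall t, derivable w t 1) ->
  (\forall t \near (0 : K), w t = 0 -> t = 0) ->
  isolated_zero (fun t => u t * w t).
Proof.
move=> [du u0 uz] dw wz; split; last 2 first.
- by rewrite u0 mul0r.
- apply: filterS2 uz wz => t ut wt /eqP.
  by rewrite mulf_eq0 => /orP[/eqP/ut|/eqP/wt].
- by move=> t; exact: (derivableM (du t) (dw t)).
Qed.

Lemma isolated_zero_unit (K : numFieldType) (v : K -> K) :
  isolated_zero v -> \forall t \near (0 : K), 1 + v t = 0 -> t = 0.
Proof.
move=> [dv v0 _].
have dw := derivable_addc (c := 1) dv.
have cw : {for (0 : K), continuous (fun t => 1 + v t)}.
  exact/differentiable_continuous/derivable1_diffP.
have : \forall t \near (0 : K), 1 + v t != 0.
  apply: (cvgr_neq0 _ cw); by rewrite v0 addr0 oner_neq0.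
by apply: filterS => t /eqP.
Qed.

Lemma blow_down_isolated (K : numFieldType) (m : option bool)
    (g : (K -> K) * (K -> K)) :
  isolated_zero g.1 -> isolated_zero g.2 ->
  isolated_zero (blow_down m g).1 /\ isolated_zero (blow_down m g).2.
Proof.
move=> g1 g2; have [d1 _ _] := g1; have [d2 _ z2] := g2.
case: m => [[]|]; split => //=; apply: isolated_zeroM => //.
- exact: derivable_addc.
- by apply: filterS z2 => t; rewrite add0r.
- exact: derivable_addc.
- exact: isolated_zero_unit.
Qed.

(** A chart is undone by cancelling the coordinate that vanishes on its exceptional curve. Near 0
    this coordinate vanishes at [t = 0] only, so two parameters with the same image are both 0 or
    allow the cancellation. *)
Lemma blow_down_injective (K : numFieldType) (m : option bool)
    (g : (K -> K) * (K -> K)) :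
  isolated_zero g.1 -> isolated_zero g.2 ->
  near_injective g -> near_injective (blow_down m g).
Proof.
move=> [_ g10 z1] [_ g20 z2] [U U0 injU].
exists (U `&` [set t | (g.1 t = 0 -> t = 0) /\ (g.2 t = 0 -> t = 0)]).
  by apply: filterI => //; apply: filterS2 z1 z2.
have cancel1 (t t' c : K) : (g.1 t = 0 -> t = 0) -> (g.1 t' = 0 -> t' = 0) ->
    g.1 t = g.1 t' -> g.1 t * (c + g.2 t) = g.1 t' * (c + g.2 t') ->
    (g.1 t, g.2 t) = (g.1 t', g.2 t').
  move=> zt zt' e1; rewrite -e1;
    have [g0|/mulfI g0 /g0/addrI->//] := eqVneq (g.1 t) 0.
  by rewrite (zt g0) zt' // -e1.
move=> t t'; rewrite !inE => -[Ut [zt1 zt2]] [Ut' [zt1' zt2']] e.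
apply: injU; rewrite ?inE //; case: m e => [[]|] /= -[].
- move=> + e2; rewrite -e2 [LHS]mulrC [RHS]mulrC.
  have [g0 _|/mulfI g0 /g0->//] := eqVneq (g.2 t) 0.
  by rewrite (zt2 g0) zt2' // -e2.
- exact: cancel1.
- exact: cancel1.
Qed.

(** The germ at [P_(n-k)]: the last germ [(t, t)] is brought down through [k] charts, [mv j] being
    the direction chosen on [E(P_j)]. *)
Fixpoint resolved_germ (K : numFieldType)
    (mv : nat -> option bool) (n k : nat) :
    (K -> K) * (K -> K) :=
  if k is k'.+1 then blow_down (mv (n - k)%N) (resolved_germ K mv n k')
  else (id, id).

Lemma resolved_germ_isolated (K : numFieldType) (mv : nat -> option bool)
    (n k : nat) :
  isolated_zero (resolved_germ K mv n k).1 /\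
  isolated_zero (resolved_germ K mv n k).2.
Proof.
elim: k => [|k [IH1 IH2]]; last exact: blow_down_isolated.
have iso : isolated_zero (id : K -> K).
  by split; [move=> t; exact: derivable_id| |exact: filterE].
by split.
Qed.

Lemma resolved_germ_injective (K : numFieldType) (mv : nat -> option bool)
    (n k : nat) :
  near_injective (resolved_germ K mv n k).
Proof.
elim: k => [|k IH]; first by exists setT; [exact: filterT|move=> t t' _ _ []].
have [i1 i2] := resolved_germ_isolated K mv n k.
exact: blow_down_injective.
Qed.

Fixpoint axes (mv : nat -> option bool) (j : nat) : option nat * option nat :=
  if j is j'.+1 then
    match mv j' with
    | None => (Some j', None)
    | Some false => (Some j', (axes mv j').2)
    | Some true => ((axes mv j').1, Some j')
    end
  else (None, None).

Definition resolution (R : realType) (mv : nat -> option bool) (n j : nat) :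
    local_transform R :=
  let g := resolved_germ (CC R) mv n (n - j) in
  LocalTransform g.1 g.2 (axes mv j).1 (axes mv j).2.

Lemma isolated_zero_holomorphic (R : realType) (f : CC R -> CC R) :
  isolated_zero f -> holomorphic_germ f.
Proof. by case=> df _ _; apply: filterE. Qed.

Lemma resolution_germ (R : realType) (mv : nat -> option bool) (n j : nat) :
  germ_at_origin (resolution R mv n j).
Proof.
have [i1 i2] := resolved_germ_isolated (CC R) mv n (n - j).
have [_ x0 _] := i1; have [_ y0 _] := i2.
split.
- exact: isolated_zero_holomorphic i1.
- exact: isolated_zero_holomorphic i2.
- exact: x0.
- exact: y0.
Qed.

Lemma resolution_blow_up (R : realType) (mv : nat -> option bool) (n j : nat) :
  (j < n)%N -> blow_up j (resolution R mv n j) (resolution R mv n j.+1).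
Proof.
move=> jn; split; first exact: resolution_germ.
rewrite /resolution; have -> : (n - j = (n - j.+1).+1)%N by lia.
rewrite [resolved_germ _ _ _ _.+1]/=.
have -> : (n - (n - j.+1).+1 = j)%N by lia.
set g := resolved_germ _ _ _ _; rewrite [axes mv j.+1]/=.
case: (mv j) => [[]|].
- by right; split=> //; apply: filterE.
- by left; exists 0; rewrite eqxx; split=> //; apply: filterE.
- left; exists 1; rewrite oner_eq0; split=> //; apply: filterE => t;
    reflexivity.
Qed.

(** * Realization of admissible decorations *)

(** Normal crossings persist under blow-up, so it suffices to exclude one at [P_(n-1)], where two
    exceptional curves meet. The last direction is along no axis, so the final germ [(t, t)] meets
    only [E(P_(n-1))], transversally. *)
Lemma resolution_minimal (R : realType) (mv : nat -> option bool) (n : nat) :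
  (0 < n)%N -> mv n.-1 = None -> (axes mv n.-1).1 <> None ->
  (axes mv n.-1).2 <> None -> minimal_resolution n (resolution R mv n).
Proof.
move=> n0 mvN X Y; pose S := resolution R mv n.
have ncS (j : nat) : (j < n)%N -> ~ normal_crossing (S j).
  move=> jn; move En : (n.-1 - j)%N => m; elim: m j jn En => [|m IH] j jn En.
    have -> : j = n.-1 by lia.
    by case=> _ [/X|/Y].
  move/(normal_crossing_blow_up (resolution_blow_up R mv jn)); apply: IH; lia.
split.
- split=> //; first exact: resolution_germ.
  exact: resolved_germ_injective.
- by move=> i i_lt; split; [exact: ncS|exact: resolution_blow_up].
- have d1 : derive1 (id : CC R -> CC R) 0 != 0.
    by rewrite derive1E derive_id oner_neq0.
  have E : axes mv n = (Some n.-1, None).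
    by case: n n0 mvN {X Y S ncS} => // n _ /= ->.
  rewrite /normal_crossing /smooth_at /resolution subnn E /=.
  split; [exact: or_introl d1|exact: or_intror erefl|exact: (fun=> d1)|].
  exact: (fun h => False_ind _ (h erefl)).
Qed.

Section Realization.
Variables (R : realType) (n : nat) (d : diagram n).
Hypothesis n3 : (3 <= n)%N.
Hypothesis adm : admissible d.

(* A satellite point lies on the curve created last, and on one of the curves
   through its predecessor: the most recent one when the path of straight edges
   starts or breaks there, the same as before otherwise. *)
Fixpoint moves (j : nat) : option bool :=
  if j is j'.+1 then
    if straight d j.+1 then
      if breaking d j || ~~ straight d j then
        Some (if moves j' is Some true then false else true)
      else moves j'
    else None
  else None.

Lemma moves_None (j : nat) : (moves j == None) = ~~ straight d j.+1.
Proof.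
elim: j => [|j IH] /=; first by case: adm => ->.
case: ifP => //= _; case: ifP => //.
by case: (straight d j.+1) IH => // ->; rewrite orbT.
Qed.

Lemma movesS (j : nat) :
  moves j.+1 = if straight d j.+2 then
      if breaking d j.+1 || ~~ straight d j.+1 then
        Some (if moves j is Some true then false else true)
      else moves j else None.
Proof. by []. Qed.

Lemma axesS (mv : nat -> option bool) (j : nat) :
  axes mv j.+1 = match mv j with
    | None => (Some j, None)
    | Some false => (Some j, (axes mv j).2)
    | Some true => ((axes mv j).1, Some j)
    end.
Proof. by []. Qed.

(** The choice records which axis is [E(P_j)]. After a satellite choice, reversing it at the next
    step follows [E(P_j)], and repeating it follows the older curve [E(P_b)]. *)
Lemma axes_moves (j : nat) :
  match moves j with
  | None => axes moves j.+1 = (Some j, None)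
  | Some true => exists2 b, (b < j)%N & axes moves j.+1 = (Some b, Some j)
  | Some false => exists2 b, (b < j)%N & axes moves j.+1 = (Some j, Some b)
  end.
Proof.
elim: j => [|j IH] //; rewrite axesS movesS.
case: ifP => // _; case: ifP => _.
  case: (moves j) IH => [[]|] => [[b bj ->]|[b bj ->]|->] /=; exists j => //.
by case: (moves j) IH => [[]|] // [b bj ->]; exists b => //; lia.
Qed.

Lemma resolution_moves : minimal_resolution n (resolution R moves n).
Proof.
have [_ stN _] := adm; have [j nj] : exists j, n.-1 = j.+1 by exists n.-2; lia.
have sN : straight d n = false by apply/negP => /straight_lt; lia.
apply: resolution_minimal; first by lia.
- by apply/eqP; rewrite moves_None (_ : n.-1.+1 = n) ?sN //; lia.
- have := axes_moves j; have := moves_None j; rewrite nj in stN *.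
  by rewrite stN; case: (moves j) => [[]|] // _ [b _ ->].
- have := axes_moves j; have := moves_None j; rewrite nj in stN *.
  by rewrite stN; case: (moves j) => [[]|] // _ [b _ ->].
Qed.

Let S := resolution R moves n.

Lemma straight_moves (i : nat) : (0 < i < n)%N ->
  ~~ straight d i <-> free_point S i.
Proof.
case: i => // j jn; have res := resolution_moves.
rewrite -moves_None (free_pointE res); last by lia.
have px l : proximate S j.+1 l <->
  (axes moves j.+1).1 = Some l \/ (axes moves j.+1).2 = Some l by [].
have := axes_moves j; move: (axes moves j.+1) px => a px.
case: (moves j) => [[]|] => [[b bj ab]|[b bj ab]|ab]; split=> //.
- by move=> fr; have /fr : proximate S j.+1 b; [apply/px; rewrite ab; left|lia].
- by move=> fr; have /fr : proximate S j.+1 b; [apply/px; rewrite ab;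
    right|lia].
- by move=> _ i /px; rewrite ab => -[[]|].
Qed.

(** At a breaking [v_(i+1)] the direction follows [E(P_i)], which makes [P_(i+2)] proximate to
    [P_i]. At a neutral one after a straight [e_(i+1)], the direction is repeated, hence follows an
    older curve, or is along no axis; either way [P_(i+2)] is not proximate to [P_i]. *)
Lemma breaking_moves (j : nat) : (j < n)%N ->
  (breaking d j <->
   exists i k, [/\ j = i.+1, (i.+2 <= k)%N, proximate_run S n i k
                 & straight d i.+1]).
Proof.
move=> jn; have res := resolution_moves; case: adm => s1 _ br.
have px i l : proximate S i l <->
  (axes moves i).1 = Some l \/ (axes moves i).2 = Some l by [].
split=> [bj|[i [k [-> ik [kn run] st]]]].
  have /andP[st st'] := br _ bj.
  case: j jn bj st st' => // i iN bi st st'.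
  have i2n := straight_lt st'.
  have pi : proximate S i.+2 i.
    apply/px; have := axes_moves i; rewrite (axesS _ i.+1) movesS st' bi.
    move: (axes moves i.+1) => a.
    by case: (moves i) => [[]|] => [[b _ ->]|[b _ ->]|->]; [right|left|left].
  have [|k ik run] := proximate_run_exists res _ pi; first by lia.
  by exists i, k.
have pi : proximate S i.+2 i by apply/run; lia.
apply: contrapT => /negP nb; move: (pi) => /px.
have ms := movesS i; rewrite st (negPf nb) in ms.
have := axes_moves i; rewrite (axesS _ i.+1) ms.
move: (axes moves i.+1) => a /=.
have := moves_None i; rewrite st.
case: ifP => _.
  case: (moves i) => [[]|] // _ [b bi ->] /=; case=> -[]; lia.
by move=> _ _ /= [[]|//]; lia.
Qed.

Lemma admissible_enriques : enriques R n d.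
Proof.
exists S; first exact: resolution_moves.
split; [exact: straight_moves| |exact: breaking_moves].
exact: maximal_straight_run resolution_moves _ straight_moves breaking_moves.
Qed.

End Realization.

Lemma enriquesP (R : realType) (n : nat) (d : diagram n) : (3 <= n)%N ->
  enriques R n d <-> admissible d.
Proof.
by move=> n3; split; [exact: enriques_admissible|exact: admissible_enriques].
Qed.

(** * Words of letters *)

(* The decorations read along the path v_0, e_1, v_1, e_2, ...: the letter 2k
   says whether v_k is breaking, the letter 2k + 1 whether e_(k+1) is curved.
   Beyond the path, even letters are false and odd ones are true. *)
Definition letter (n : nat) (d : diagram n) (p : nat) : bool :=
  if odd p then ~~ straight d p./2.+1 else breaking d p./2.

Lemma letter_even (n : nat) (d : diagram n) (k : nat) :
  letter d k.*2 = breaking d k.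
Proof. by rewrite /letter odd_double doubleK. Qed.

Lemma letter_odd (n : nat) (d : diagram n) (k : nat) :
  letter d k.*2.+1 = ~~ straight d k.+1.
Proof. by rewrite /letter /= odd_double /= uphalf_double. Qed.

Lemma parityP (p : nat) : (exists k, p = k.*2) \/ (exists k, p = k.*2.+1).
Proof.
by have := odd_double_half p; case: odd => <-; [right|left]; exists p./2.
Qed.

Lemma breakingE (n : nat) (d : diagram n) (i : 'I_n) : breaking d i = d.1 i.
Proof. by rewrite /breaking valK. Qed.

Lemma straightE (n : nat) (d : diagram n) (i : 'I_n.-1) :
  straight d i.+1 = d.2 i.
Proof. by rewrite /straight /= valK. Qed.

Lemma letter_inj (n : nat) (d d' : diagram n) :
  (forall p, (p < n.*2.-1)%N -> letter d p = letter d' p) -> d = d'.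
Proof.
move=> dd'; rewrite [LHS]surjective_pairing [RHS]surjective_pairing.
congr pair; apply/ffunP => i.
  by rewrite -!breakingE -!letter_even dd' //; have := ltn_ord i; lia.
rewrite -!straightE; apply: negb_inj.
by rewrite -!letter_odd dd' //; have := ltn_ord i; lia.
Qed.

Definition diagram_of_letters (n : nat) (l : nat -> bool) : diagram n :=
  ([ffun k : 'I_n => l k.*2], [ffun j : 'I_n.-1 => ~~ l j.*2.+1]).

Lemma letter_diagram_of_letters (n : nat) (l : nat -> bool) (p : nat) :
  (p < n.*2.-1)%N -> letter (diagram_of_letters n l) p = l p.
Proof.
case: (parityP p) => -[k ->] pn.
  have kn : (k < n)%N by lia.
  by rewrite letter_even (breakingE _ (Ordinal kn)) ffunE.
have kn : (k < n.-1)%N by lia.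
by rewrite letter_odd (straightE _ (Ordinal kn)) ffunE negbK.
Qed.

Definition sparse (l : nat -> bool) : Prop := forall p, ~~ (l p && l p.+1).

Lemma sparse_letter (n : nat) (d : diagram n) :
  ~~ letter d n.-1.*2 ->
  (forall p, (p.+1 < n.*2.-1)%N -> ~~ (letter d p && letter d p.+1)) ->
  sparse (letter d).
Proof.
move=> last0 h p; have [/h//|np] := ltnP p.+1 n.*2.-1.
have even0 k : (n.-1 <= k)%N -> letter d k.*2 = false.
  rewrite leq_eqVlt => /orP[/eqP <-|nk]; first exact: negPf.
  by rewrite letter_even; apply/negP => /breaking_lt; lia.
case: (parityP p) => -[k pk]; rewrite pk ?even0 //; first by lia.
by rewrite -doubleS even0 ?andbF //; lia.
Qed.

(** The missing edge [e_n] reads as a true letter right after the last one. *)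
Lemma sparse_last (n : nat) (d : diagram n) : (0 < n)%N ->
  sparse (letter d) -> letter d n.-1.*2 = false.
Proof.
move=> n0 /(_ n.-1.*2); rewrite letter_odd prednK //.
have -> : straight d n = false by apply/negP => /straight_lt; lia.
by rewrite andbT => /negPf.
Qed.

Lemma admissibleP (n : nat) (d : diagram n) : (3 <= n)%N ->
  admissible d <->
  [/\ letter d 1, ~~ letter d (n.*2 - 3)%N & sparse (letter d)].
Proof.
move=> n3; have -> : (n.*2 - 3 = n.-2.*2.+1)%N by lia.
rewrite (letter_odd d 0) letter_odd negbK (_ : n.-2.+1 = n.-1); last by lia.
split=> -[s1 sn br]; split=> //.
  move=> p; case: (parityP p) => -[k ->].
    rewrite letter_even letter_odd; apply/negP => /andP[/br/andP[_ ->]] //.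
  rewrite -doubleS letter_even letter_odd.
  by apply/negP => /andP[+ /br/andP[]] => /negPf ->.
move=> k bk; have := br k.*2; rewrite letter_even bk letter_odd /= negbK => ->.
rewrite andbT; case: k bk => [|k] bk.
  by have := br 0%N; rewrite (letter_even d 0) (letter_odd d 0) bk s1.
by have := br k.*2.+1; rewrite -doubleS letter_even bk letter_odd andbT negbK.
Qed.

(** The reflection of [p] to [2n - 1 - p] swaps the letter [2k] of [v_k] with the letter
    [2(n - k) - 1] of [e_(n-k)]. It acts on the letters 3 to [2n - 4], from [e_2] to [v_(n-2)]. *)
Lemma letter_dual (n : nat) (d : diagram n) (p : nat) :
  (3 <= n)%N -> (p < n.*2.-1)%N ->
  letter (dual d) p =
    if (2 < p < n.*2 - 3)%N then letter d (n.*2.-1 - p)%N else p == 1%N.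
Proof.
move=> n3; case: (parityP p) => -[k ->] pn.
  have kn : (k < n)%N by lia.
  rewrite letter_even (breakingE _ (Ordinal kn)) ffunE /=.
  have -> : (2 < k.*2 < n.*2 - 3)%N = (2 <= k <= n - 2)%N by lia.
  case: ifP => /= kr; last by lia.
  rewrite (_ : (n.*2.-1 - k.*2 = (n - k).-1.*2.+1)%N); last by lia.
  by rewrite letter_odd prednK //; lia.
have kn : (k < n.-1)%N by lia.
rewrite letter_odd (straightE _ (Ordinal kn)) ffunE /=.
have -> : (2 < k.*2.+1 < n.*2 - 3)%N = (2 <= k.+1 <= n - 2)%N by lia.
case: ifP => kr; last by lia.
rewrite negbK (_ : (n.*2.-1 - k.*2.+1 = (n - k.+1).*2)%N) ?letter_even //.
by lia.
Qed.

(** The equations at [p = 1] and [p = 2n - 3], outside the reflected range, already say that [e_1]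
    is curved and [e_(n-1)] straight. *)
Lemma self_dualP (R : realType) (n : nat) (d : diagram n) : (3 <= n)%N ->
  self_dual R n d <->
  sparse (letter d) /\
  forall p, (p < n.*2.-1)%N -> letter d p =
    if (2 < p < n.*2 - 3)%N then letter d (n.*2.-1 - p)%N else p == 1%N.
Proof.
move=> n3; split=> [[/enriquesP-/(_ n3)/(admissibleP _ n3)[_ _ sp] dd]|[sp dd]].
  by split=> // p pn; rewrite -(letter_dual _ n3 pn) dd.
split; last by apply: letter_inj => p pn; rewrite letter_dual // -dd.
apply/enriquesP => //; apply/admissibleP => //; split=> //.
  by rewrite dd //; lia.
by rewrite dd; [rewrite ltnn andbF; lia|lia].
Qed.

(** * Self-dual words and their first halves *)

Section HalfWord.
Variables (R : realType) (n : nat).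
Hypothesis n3 : (3 <= n)%N.

(* The two middle letters are equal by duality, and not both true. *)
Lemma self_dual_middle (d : diagram n) : self_dual R n d ->
  letter d n.-1 = false /\ letter d n = false.
Proof.
move=> /(self_dualP _ _ n3)[sp dd].
have n1 := dd n.-1 ltac:(lia); have n2 := dd n ltac:(lia).
have := sp n.-1; rewrite prednK; last by lia.
(* For [n = 3] no letter is reflected, and the letters 2 and 3 are false by the end conventions. *)
move: n1 n2; have [n4|n4] := boolP (n == 3)%N.
  have -> : (2 < n.-1 < n.*2 - 3)%N = false by lia.
  have -> : (2 < n < n.*2 - 3)%N = false by lia.
  have -> : n.-1 == 1%N = false by lia.
  by have -> : n == 1%N = false by lia.
have -> : (2 < n.-1 < n.*2 - 3)%N by lia.
have -> : (n.*2.-1 - n.-1 = n)%N by lia.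
by move=> -> _; rewrite andbb => /negPf ->.
Qed.

Lemma self_dual_half_inj (d d' : diagram n) :
  self_dual R n d -> self_dual R n d' ->
  (forall p, (2 < p < n.-1)%N -> letter d p = letter d' p) -> d = d'.
Proof.
move=> sd sd' e; have [m1 m2] := self_dual_middle sd.
have [m1' m2'] := self_dual_middle sd'.
have /(self_dualP _ _ n3)[_ dd] := sd; have /(self_dualP _ _ n3)[_ dd'] := sd'.
have low p : (2 < p <= n)%N -> letter d p = letter d' p.
  move=> pn; have [/e//|pn1] := boolP (2 < p < n.-1)%N.
  have [->|->] : p = n.-1 \/ p = n by lia.
    by rewrite m1.
  by rewrite m2.
apply: letter_inj => p pn; rewrite dd // dd' //; case: ifP => // pr.
have [pn1|pn1] := leqP p n; last by apply: low; lia.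
by have := low p; rewrite dd // dd' // pr; apply; lia.
Qed.

Lemma self_dual_half_surj (h : nat -> bool) :
  (forall p, (2 < p)%N -> (p.+1 < n.-1)%N -> ~~ (h p && h p.+1)) ->
  exists2 d, self_dual R n d &
    forall p, (2 < p < n.-1)%N -> letter d p = h p.
Proof.
move=> sp.
(* The middle letters [n - 1] and [n] fall under the default [p == 1], hence are false; they
   separate [h] from its mirror image, so sparseness is only tested inside [h]. *)
pose l p := if (2 < p < n.-1)%N then h p
  else if (n < p < n.*2 - 3)%N then h (n.*2.-1 - p)%N else p == 1%N.
exists (diagram_of_letters n l); last first.
  by move=> p pn; rewrite letter_diagram_of_letters /l ?pn //; lia.
apply/self_dualP => //; split.
  apply: sparse_letter => [|p pn].
    by rewrite letter_diagram_of_letters /l; [do 2![case: ifP; [lia|]];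
      lia|lia].
  rewrite !letter_diagram_of_letters; [|lia..].
  rewrite /l; case: ifP => p1.
    case: ifP => p2; first by apply: sp; lia.
    by case: ifP => p3; rewrite ?andbF; lia.
  case: ifP => p2.
    have -> : (2 < p.+1 < n.-1)%N = false by lia.
    case: ifP => p4; last by lia.
    have -> : (n.*2.-1 - p = (n.*2.-1 - p.+1).+1)%N by lia.
    by rewrite andbC; apply: sp; lia.
  case: eqP => //= p3; do 2![case: ifP; [lia|]]; lia.
move=> p pn; rewrite letter_diagram_of_letters //.
case: ifP => pr; last by rewrite /l; do 2![case: ifP; [lia|]].
rewrite letter_diagram_of_letters; last by lia.
rewrite /l.
have [p1|p1] : (p < n.-1)%N \/ (n.-1 <= p)%N by lia.
  have -> : (2 < p < n.-1)%N by lia.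
  have -> : (2 < n.*2.-1 - p < n.-1)%N = false by lia.
  have -> : (n < n.*2.-1 - p < n.*2 - 3)%N by lia.
  by congr h; lia.
have -> : (2 < p < n.-1)%N = false by lia.
have [p2|p2] : (n < p)%N \/ (p <= n)%N by lia.
  have -> : (2 < n.*2.-1 - p < n.-1)%N by lia.
  by have -> : (n < p < n.*2 - 3)%N by lia.
by do 3![case: ifP; [lia|]]; lia.
Qed.

End HalfWord.

(** * Bijections and counting *)

Lemma letter_initial_part (n m : nat) (d : diagram n) (p : nat) :
  (p < m.-1.*2)%N -> letter (initial_part m d) p = letter d p.
Proof.
case: (parityP p) => -[k ->] pm.
  have km : (k < m)%N by lia.
  rewrite !letter_even (breakingE _ (Ordinal km)) ffunE /=.
  by have -> : (k.+1 < m)%N by lia.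
have km : (k < m.-1)%N by lia.
by rewrite !letter_odd (straightE _ (Ordinal km)) ffunE.
Qed.

Lemma letter_initial_part_last (n m : nat) (d : diagram n) :
  (0 < m)%N -> letter (initial_part m d) m.-1.*2 = false.
Proof.
move=> m0; have km : (m.-1 < m)%N by lia.
by rewrite letter_even (breakingE _ (Ordinal km)) ffunE /= prednK // ltnn.
Qed.

(* The middle letters n - 1 and n are the last two letters of the initial part
   when n is even, and the two before the last when n is odd. *)
Lemma initial_part_bij (R : realType) (n m : nat) :
  (3 <= n)%N -> (n + 2 <= m.*2 <= n + 3)%N ->
  set_bij (self_dual R n)
    [set d | [/\ enriques R m d, letter d n.-1 = false & letter d n = false]]
    (@initial_part n m).
Proof.
move=> n3 nm; have m3 : (3 <= m)%N by lia.
split.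
- move=> d sd /=; have [mid1 mid2] := self_dual_middle n3 sd.
  have /(self_dualP _ _ n3)[sp dd] := sd.
  have ini p : (p < m.-1.*2)%N -> letter (initial_part m d) p = letter d p.
    exact: letter_initial_part.
  have m0 : (0 < m)%N by lia.
  have ini_last := letter_initial_part_last d m0.
  have mid p : p = n.-1 \/ p = n -> letter (initial_part m d) p = false.
    move=> pn; have [pm|pm] : (p < m.-1.*2)%N \/ p = m.-1.*2 by lia.
      by rewrite ini //; case: pn => ->.
    by rewrite pm.
  split; [|by apply: mid; left|by apply: mid; right].
  apply/enriquesP => //; apply/admissibleP => //; split.
  + by rewrite ini; [rewrite (dd 1%N) //|]; lia.
  (* The letter of [e_(m-1)] is a middle letter: [n - 1] for even [n], [n] for odd [n]. *)
  + have e : (m.*2 - 3 = n.-1 \/ m.*2 - 3 = n)%N by lia.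
    by rewrite (mid _ e).
  + apply: sparse_letter; rewrite ?ini_last // => p pm.
    have [pm1|pm1] : (p.+1 < m.-1.*2)%N \/ p.+1 = m.-1.*2 by lia.
      by rewrite !ini //; lia.
    by rewrite pm1 ini_last andbF.
- move=> d d' /set_mem sd /set_mem sd' e.
  apply: (self_dual_half_inj n3 sd sd') => p pn.
  by rewrite -(letter_initial_part (m := m)) ?e ?letter_initial_part //; lia.
- move=> d' [/enriquesP-/(_ m3)/(admissibleP _ m3)[s1 _ sp] mid1 mid2].
  have [p _ _|d sd dh] := self_dual_half_surj R n3 (h := letter d').
    exact: sp.
  exists d => //.
  have [mid1' mid2'] := self_dual_middle n3 sd.
  have /(self_dualP _ _ n3)[_ dd] := sd.
  apply: letter_inj => p pm.
  have [pe|pm1] : p = m.-1.*2 \/ (p < m.-1.*2)%N by lia.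
    by rewrite pe letter_initial_part_last ?sparse_last //; lia.
  rewrite letter_initial_part //.
  have [/dh//|p2] := boolP (2 < p < n.-1)%N.
  have [->|[->|p3]] : p = n.-1 \/ p = n \/ (p <= 2)%N by lia.
  + by rewrite mid1.
  + by rewrite mid2.
  have pn : (p < n.*2.-1)%N by lia.
  rewrite dd //; have -> : (2 < p)%N = false by lia.
  (* Letter 1 is true, so its neighbours 0 and 2 are false, as the end conventions require. *)
  move: (sp 0%N) (sp 1%N); rewrite s1 /= andbT => d0 d2.
  by case: p p3 {p2 pm pm1 pn} => [|[|[|]]] // _;
    rewrite ?s1 ?(negPf d0) ?(negPf d2).
Qed.

(** The split on the first letter is the recursion of [fib]; a list lets [index] number the
    words. *)
Fixpoint sparse_words (k : nat) : seq (seq bool) :=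
  match k with
  | 0 => [:: [::]]
  | 1 => [:: [:: false]; [:: true]]
  | (k'.+1 as k1).+1 =>
      [seq false :: w | w <- sparse_words k1] ++
      [seq [:: true, false & w] | w <- sparse_words k']
  end%N.

Lemma sparse_wordsSS (k : nat) :
  sparse_words k.+2 = [seq false :: w | w <- sparse_words k.+1] ++
                      [seq [:: true, false & w] | w <- sparse_words k].
Proof. by []. Qed.

Lemma nat_ind2 (P : nat -> Prop) :
  P 0%N -> P 1%N -> (forall k, P k -> P k.+1 -> P k.+2) -> forall k, P k.
Proof.
move=> P0 P1 PS k; suff [] : P k /\ P k.+1 by [].
by elim: k => // k [Pk Pk1]; split=> //; exact: PS.
Qed.

Lemma size_sparse_words (k : nat) : size (sparse_words k) = fib k.+2.
Proof.
elim/nat_ind2: k => // k IH IH1.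
by rewrite sparse_wordsSS size_cat !size_map IH IH1.
Qed.

Definition not_both (a b : bool) := ~~ (a && b).

Lemma mem_sparse_words (k : nat) (w : seq bool) :
  (w \in sparse_words k) = (size w == k) && sorted not_both w.
Proof.
elim/nat_ind2: k w => [[]|[|[] []]|k IH IH1 w] //.
rewrite sparse_wordsSS mem_cat.
have inj0 : injective (cons false) by move=> ? ? [].
have inj1 : injective (fun w => [:: true, false & w]) by move=> ? ? [].
case: w => [|[] w].
- by apply/negbTE/norP; split; apply/negP => /mapP[].
- have -> : true :: w \in [seq false :: w | w <- sparse_words k.+1] = false.
    by apply/negP => /mapP[].
  case: w => [|[] w] /=.
  + by apply/negP => /mapP[].
  + by rewrite andbF; apply/negP => /mapP[? _ []].
  + by rewrite (mem_map inj1) IH !eqSS; case: w.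
rewrite (mem_map inj0) IH1.
have -> : false :: w \in
    [seq [:: true, false & w] | w <- sparse_words k] = false.
  by apply/negP => /mapP[].
by rewrite orbF /= eqSS; case: w.
Qed.

Lemma uniq_sparse_words (k : nat) : uniq (sparse_words k).
Proof.
elim/nat_ind2: k => // k IH IH1; rewrite sparse_wordsSS cat_uniq.
rewrite !map_inj_uniq ?IH ?IH1 /=; try by move=> ? ? [].
by rewrite andbT; apply/hasPn => _ /mapP[w _ ->]; apply/negP => /mapP[].
Qed.

Lemma card_self_dual (R : realType) (n : nat) :
  (3 <= n)%N -> self_dual R n #= `I_(fib (n - 2)).
Proof.
move=> n3; pose W := sparse_words (n - 4).
have -> : fib (n - 2) = size W.
  (* For [n = 3] the truncated [n - 4] is 0, and [fib 2 = fib 1]. *)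
  rewrite size_sparse_words; have [n4|n4] := leqP 4 n.
    by congr fib; lia.
  by have -> : n = 3%N by lia.
pose word (d : diagram n) := mkseq (fun i => letter d (i + 3)) (n - 4).
have wordW d : self_dual R n d -> word d \in W.
  move=> /(self_dualP _ _ n3)[sp _];
    rewrite mem_sparse_words size_mkseq eqxx /=.
  apply/(sortedP false) => i; rewrite size_mkseq => iw.
  by rewrite !nth_mkseq; [exact: sp|lia..].
apply/card_set_bijP; exists (fun d => index (word d) W); split.
- by move=> d /wordW; rewrite -index_mem.
- move=> d d' /set_mem sd /set_mem sd' e; apply: (self_dual_half_inj n3 sd sd').
  have ww : word d = word d'.
    by rewrite -(nth_index [::] (wordW _ sd)) e nth_index // wordW.
  move=> p pn; have := congr1 (nth false ^~ (p - 3)%N) ww.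
  by rewrite !nth_mkseq ?subnK //; lia.
- move=> i /= iW; pose w := nth [::] W i.
  have : w \in W by exact: mem_nth.
  rewrite mem_sparse_words => /andP[/eqP sw /(sortedP false) spw].
  have [p p2 pn|d sd dh] := self_dual_half_surj R n3 (h := fun p =>
    nth false w (p - 3)).
    by rewrite subSn //; apply: spw; lia.
  exists d => //; have -> : word d = w;
    last by rewrite index_uniq // uniq_sparse_words.
  apply: (@eq_from_nth _ false); rewrite size_mkseq ?sw // => j jw.
  by rewrite nth_mkseq // dh ?addnK //; lia.
Qed.

Theorem proposition6p14 (R : realType) (n : nat) (hn : (3 <= n)%N) :
  [/\ ~~ odd n ->
        set_bij (self_dual R n) (enriques R (n + 2)./2)
          (@initial_part n (n + 2)./2),
      odd n ->
        set_bij (self_dual R n) (enriques_neutral R (n + 3)./2)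
          (@initial_part n (n + 3)./2)
    & self_dual R n #= `I_(fib (n - 2))].
Proof.
split=> [ev|od|]; last exact: card_self_dual.
- set m := (n + 2)./2; have mE : m.*2 = (n + 2)%N by lia.
  (* The letters [n - 1] and [n] belong to [e_(m-1)] and [v_(m-1)], straight and neutral in every
     Enriques diagram. *)
  suff -> : enriques R m =
      [set d | [/\ enriques R m d, letter d n.-1 = false & letter d n = false]].
    by apply: initial_part_bij => //; lia.
  apply/seteqP; split=> d; last by case.
  move=> ed; have m3 : (3 <= m)%N by lia.
  have /(enriquesP _ _ m3)/(admissibleP _ m3)[_ l1 sp] := ed; split=> //.
    by apply: negbTE; rewrite (_ : n.-1 = m.*2 - 3)%N //; lia.
  by rewrite (_ : n = m.-1.*2); [apply: sparse_last => //|]; lia.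
- set m := (n + 3)./2; have mE : m.*2 = (n + 3)%N by lia.
  have m3 : (3 <= m)%N by lia.
  have nE : n = (m.*2 - 3)%N by lia.
  have n1E : n.-1 = (m - 2).*2 by lia.
  (* The letter [n] belongs to [e_(m-1)], always straight, and the letter [n - 1] to [v_(m-2)],
     whose neutrality defines the set A_m. *)
  suff -> : enriques_neutral R m =
      [set d | [/\ enriques R m d, letter d n.-1 = false & letter d n = false]].
    by apply: initial_part_bij => //; lia.
  apply/seteqP; split=> d; rewrite /= n1E letter_even.
    move=> [ed nb]; split; [by []|exact: negbTE|].
    have /(enriquesP _ _ m3)/(admissibleP _ m3)[_ + _] := ed.
    by rewrite -nE => /negbTE.
  by case=> ed nb _; split=> //; rewrite nb.
Qed.
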